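(* The second quantization of a quantum cluster algebra without coefficients is always trivial; that is, if $A_q$ is a quantum cluster algebra without coefficients, then every second quantization $A_{p,q}$ of $A_q$ is trivial.
   Context: Notation: $[1,n]=\{1,\dots,n\}$; $[a]_+=\max\{a,0\}$, componentwise on vectors. Quantum cluster algebras without coefficients. $B=(b_{ij})$ is an $n\times n$ skew-symmetrizable integer matrix ($DB$ skew-symmetric for a positive diagonal $D$) and $\Lambda=(\lambda_{ij})$ a skew-symmetric integer $n\times n$ matrix with $B^\top\Lambda=D$ (compatible pair). With $q$ formal, the quantum torus is the $\mathbb Z[q^{\pm1/2}]$-algebra with basis $X^e$, $e\in\mathbb Z^n$, $X^eX^f=q^{\frac12e^\top\Lambda f}X^{e+f}$, with skew-field of fractions $\mathscr F_q$; $X_i=X^{e_i}$; the initial seed is $(X,B,\Lambda)$. Mutation $\mu_k$ ($k\in[1,n]$): $X_k\mapsto X^{-e_k+[b_k]_+}+X^{-e_k+[-b_k]_+}$ ($b_k$ the $k$-th column of $B$); $b'_{ij}=-b_{ij}$ if $i=k$ or $j=k$, else $b'_{ij}=b_{ij}+\mathrm{sgn}(b_{ik})[b_{ik}b_{kj}]_+$; a skew-symmetric matrix $R$ ($=\Lambda$ or $W$) goes to the skew-symmetric $R'$ with $R'_{kj}=-R_{kj}+\sum_l[b_{lk}]_+R_{lj}$ for $j\ne k$ and $R'_{ij}=R_{ij}$ for $i,j\neq k$. $A_q$ is the $\mathbb Z[q^{\pm1/2}]$-subalgebra of $\mathscr F_q$ generated by all cluster variables of all iteratively mutated seeds. Second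 quantization. A triple $(B,\Lambda,W)$, $W$ a skew-symmetric integer $n\times n$ matrix, is compatible if $(B,\Lambda)$ is a compatible pair and every triple obtained from it by iterated mutation satisfies, for all $j,k\in[1,n]$, $k\ne j$: (C2) if $b_{uk}\ne0$ then $W_{uj}\lambda_{kj}=W_{kj}\lambda_{uj}$; (C3) if $b_{uk}b_{vk}\ne0$ then $W_{uj}\lambda_{vj}=W_{vj}\lambda_{uj}$; (C4) $\sum_{t:\lambda_{tj}=0}W_{tj}b_{tk}=0$. A second quantization of $A_q$ is given by such a $W$ for which the associated Poisson matrices $\Omega$ ($\omega_{ij}=W_{ij}[\lambda_{ij}]_{q^{1/2}}/\lambda_{ij}$ if $\lambda_{ij}\ne0$, $\omega_{ij}=W_{ij}$ if $\lambda_{ij}=0$, with $[a]_{q^{1/2}}=\frac{q^{a/2}-q^{-a/2}}{q^{1/2}-q^{-1/2}}$) have entries in $\mathbb Z[q^{\pm1/2}]$: it is the $\mathbb Z[p^{\pm1/2},q^{\pm1/2}]$-algebra $A_{p,q}$ generated by all cluster variables obtained by iterated mutation (same formulas, $X$ replaced by $Y$) from the torus with $Y^eY^f=p^{\frac12e^\top Wf}q^{\frac12e^\top\Lambda f}Y^{e+f}$. It is trivial if for a certain seed there is a partition of $[1,n]$ into subsets $J_1,\dots,J_s$ for which both $W$ and $\Lambda$ are block diagonal and $W|_{J_i\times J_i}=a_i\Lambda|_{J_i\times J_i}$ with $a_i\in\mathbb Z$ for all $i$; otherwise it is non-trivial. *)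

(* Defs.v *)
From HB Require Import structures.
From mathcomp Require Import all_boot all_order all_algebra.

Set Implicit Arguments.
Unset Strict Implicit.
Unset Printing Implicit Defensive.

Import Order.TTheory GRing.Theory Num.Theory.
Local Open Scope ring_scope.

Inductive subring_gen (R : nzRingType) (G : R -> Prop) : R -> Prop :=
| SubringGen x of G x : subring_gen G x
| SubringOne : subring_gen G 1
| SubringSub x y of subring_gen G x & subring_gen G y : subring_gen G (x - y)
| SubringMul x y of subring_gen G x & subring_gen G y : subring_gen G (x * y).

(* The ring of Laurent polynomials Z[h_s^{+-1} : s in P] inside a field K. *)
Definition laurent (K : fieldType) (P : finType) (h : P -> K) : K -> Prop :=
  subring_gen (fun z => exists s, z = h s \/ z = (h s)^-1).

(* Q(q^{1/2}), with q^{1/2} the indeterminate. *)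
Definition Kq : fieldType := {fraction {poly int}}.
Definition qhalf : Kq := tofrac 'X.

(* Q(p^{1/2}, q^{1/2}), with q^{1/2} the inner and p^{1/2} the outer *)
(* indeterminate. *)
Definition Kpq : fieldType := {fraction {poly {poly int}}}.

(* Quantization parameters are indexed by a finite type: unit for q alone, *)
(* bool for the pair p (true), q (false).  The skew-symmetric matrix attached *)
(* to p is W and the one attached to q is Lambda. *)
Definition par_q : unit -> Kq := fun _ => qhalf.
Definition par_pq : bool -> Kpq :=
  fun s => if s then tofrac 'X else tofrac 'X%:P.

Definition pos_part (a : int) : int := Num.max a 0.

Definition skew_symmetric n (R : 'M[int]_n) : Prop := R^T = - R.

Definition compatible_pair n (B L : 'M[int]_n) : Prop :=
  skew_symmetric L /\
  exists d : 'rV[int]_n,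
    [/\ forall i, 0 < d 0 i, skew_symmetric (diag_mx d *m B)
      & B^T *m L = diag_mx d].

Definition mut_exch n (k : 'I_n) (B : 'M[int]_n) : 'M[int]_n :=
  \matrix_(i, j) if (i == k) || (j == k) then - B i j
                 else B i j + Num.sg (B i k) * pos_part (B i k * B k j).

Definition mut_form_row n (k : 'I_n) (B R : 'M[int]_n) (j : 'I_n) : int :=
  - R k j + \sum_l pos_part (B l k) * R l j.

Definition mut_form n (k : 'I_n) (B R : 'M[int]_n) : 'M[int]_n :=
  \matrix_(i, j) if i == k then (if j == k then 0 else mut_form_row k B R j)
                 else if j == k then - mut_form_row k B R i
                 else R i j.

Record seed (P : finType) (F : Type) (n : nat) := Seed {
  cluster : 'I_n -> F;
  exch : 'M[int]_n;
  forms : P -> 'M[int]_n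
}.

Section Seeds.

Variables (K : fieldType) (P : finType) (h : P -> K).
Variables (F : unitAlgType K) (n : nat).
Implicit Types (S : seed P F n) (k : 'I_n) (e f : 'cV[int]_n).

(* q^{e^T Lambda f / 2}, resp. p^{e^T W f / 2} q^{e^T Lambda f / 2}. *)
Definition torus_scalar S e f : K :=
  \prod_(s : P) h s ^ ((e^T *m forms S s *m f) 0 0).

(* X^e in terms of X_1, ..., X_n; the scalar is the one forced by the torus *)
(* relations on the ordered product X_1^{e_1} ... X_n^{e_n}. *)
Definition monomial S e : F :=
  (\prod_(s : P)
     h s ^ (- \sum_(i < n) \sum_(j < n | (i < j)%N)
                e i 0 * e j 0 * forms S s i j))
  *: \prod_(i < n) cluster S i ^ e i 0.

Definition exch_var S k : F :=
  monomial S (\col_i (pos_part (exch S i k) - (i == k)%:Z))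
  + monomial S (\col_i (pos_part (- exch S i k) - (i == k)%:Z)).

Definition mutate S k : seed P F n :=
  Seed (fun i => if i == k then exch_var S k else cluster S i)
       (mut_exch k (exch S))
       (fun s => mut_form k (exch S) (forms S s)).

Definition mutate_seq S (ks : seq 'I_n) : seed P F n := foldl mutate S ks.

Definition torus_elt S (z : F) : Prop :=
  exists (r : seq 'cV[int]_n) (c : 'cV[int]_n -> K),
    (forall e, laurent h (c e)) /\ z = \sum_(e <- r) c e *: monomial S e.

(* F is the skew-field of fractions of the quantum torus with basis X^e, where *)
(* X is the cluster of S. *)
Record torus_fractions S : Prop := TorusFractions {
  skew_field : forall z : F, z != 0 -> z \is a GRing.unit;
  torus_mul : forall e f,
    monomial S e * monomial S f = torus_scalar S e f *: monomial S (e + f);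
  torus_free : forall (r : seq 'cV[int]_n) (c : 'cV[int]_n -> K),
    uniq r -> (forall e, laurent h (c e)) ->
    \sum_(e <- r) c e *: monomial S e = 0 -> forall e, e \in r -> c e = 0;
  torus_frac : forall z : F, exists a b : F,
    [/\ torus_elt S a, torus_elt S b, b != 0 & z = a / b]
}.

Definition cluster_subalgebra S : F -> Prop :=
  subring_gen (fun z =>
    (exists2 c, laurent h c & z = c%:A) \/
    (exists ks i, z = cluster (mutate_seq S ks) i)).

End Seeds.

Record cluster_algebra (K : fieldType) (P : finType) (h : P -> K) (n : nat) :=
  ClusterAlgebra {
    ambient : unitAlgType K;
    init : seed P ambient n;
    init_torus : torus_fractions h init;
    carrier : ambient -> Prop;
    carrierP : forall z, carrier z <-> cluster_subalgebra h init z
  }.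

Definition mutated_seed (K : fieldType) (P : finType) (h : P -> K) n
    (A : cluster_algebra h n)
    (ks : seq 'I_n) : seed P (ambient A) n :=
  mutate_seq h (init A) ks.

Record quantum_cluster_algebra (n : nat) := QuantumClusterAlgebra {
  qca_algebra :> cluster_algebra par_q n;
  qca_compatible :
    compatible_pair (exch (init qca_algebra)) (forms (init qca_algebra) tt)
}.

Definition second_conditions n (B L W : 'M[int]_n) : Prop :=
  forall j k : 'I_n, k != j ->
    [/\ forall u, B u k != 0 -> W u j * L k j = W k j * L u j,
        forall u v, B u k * B v k != 0 -> W u j * L v j = W v j * L u j
      & \sum_(t | L t j == 0) W t j * B t k = 0].

(* [a]_{q^{1/2}} *)
Definition qint (a : int) : Kq :=
  (qhalf ^ a - qhalf ^ (- a)) / (qhalf - qhalf^-1).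

Definition poisson_mx n (L W : 'M[int]_n) : 'M[Kq]_n :=
  \matrix_(i, j) if L i j == 0 then (W i j)%:~R
                 else (W i j)%:~R * qint (L i j) / (L i j)%:~R.

Record second_quantization n (A : quantum_cluster_algebra n) :=
  SecondQuantization {
    sq_algebra :> cluster_algebra par_pq n;
    sq_exch : exch (init sq_algebra) = exch (init A);
    sq_form_q : forms (init sq_algebra) false = forms (init A) tt;
    sq_form_p : skew_symmetric (forms (init sq_algebra) true);
    sq_compatible : forall ks,
      let S := mutated_seed sq_algebra ks in
      second_conditions (exch S) (forms S false) (forms S true);
    sq_integral : forall ks i j,
      let S := mutated_seed sq_algebra ks in
      laurent par_q (poisson_mx (forms S false) (forms S true) i j)
  }.

Definition block_proportional n (L W : 'M[int]_n) : Prop :=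
  exists (J : {set {set 'I_n}}) (a : {set 'I_n} -> int),
    [/\ partition J [set: 'I_n],
        forall J1 J2 i j, J1 \in J -> J2 \in J -> J1 != J2 ->
          i \in J1 -> j \in J2 -> W i j = 0 /\ L i j = 0
      & forall J1 i j, J1 \in J -> i \in J1 -> j \in J1 ->
          W i j = a J1 * L i j].

Definition trivial n (A : quantum_cluster_algebra n)
    (Q : second_quantization A) : Prop :=
  exists ks, let S := mutated_seed Q ks in
    block_proportional (forms S false) (forms S true).

(* Main.v *)
Require Import Defs.
From mathcomp Require Import all_boot all_order all_algebra.
From mathcomp Require Import ring.

(** The initial seed already witnesses triviality.  Fix [k != j].  By (C3), the
    vectors [(W t j)_t] and [(L t j)_t] are proportional on the neighbours [t]
    of [k] with [L t j != 0], so the vanishing of the [(k, j)] entry of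
    [B^T *m L] together with (C4) makes the [(k, j)] entry of [B^T *m W] vanish
    too.  Hence [B^T *m W] is diagonal, and as [B] is nondegenerate, each
    column of [W] is a rational multiple [r_j] of the same column of [L].  The
    integrality of the Poisson matrix forces [L i j] to divide [W i j], so
    [r_j] is an integer.  By skew-symmetry [L i j = 0] unless [r_i = r_j]: the
    blocks are the level sets of [r]. *)

Set Implicit Arguments.
Unset Strict Implicit.
Unset Printing Implicit Defensive.

Import Order.TTheory GRing.Theory Num.Theory.
Local Open Scope ring_scope.

Lemma qhalf_neq0 : qhalf != 0.
Proof. by rewrite /qhalf tofrac_eq0 polyX_eq0. Qed.

Lemma laurent_par_q_clear z :
  laurent par_q z ->
  exists (m : nat) (p : {poly int}), z * qhalf ^+ m = tofrac p.
Proof.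
elim=> [_ [s [->|->]]||x y _ [m [p Ep]] _ [m' [p' Ep']]
         |x y _ [m [p Ep]] _ [m' [p' Ep']]].
- by exists 0%N, 'X; rewrite mulr1.
- by exists 1%N, 1; rewrite expr1 mulVf ?qhalf_neq0 // tofrac1.
- by exists 0%N, 1; rewrite mulr1 tofrac1.
- exists (m + m')%N, (p * 'X^m' - p' * 'X^m).
  rewrite tofracB !tofracM !tofracXn -Ep -Ep' -/qhalf exprD; ring.
- by exists (m + m')%N, (p * p'); rewrite tofracM -Ep -Ep' exprD; ring.
Qed.

Lemma qintN a : qint (- a) = - qint a.
Proof. by rewrite /qint opprK -mulNr opprB. Qed.

Lemma qhalf_sub_inv_neq0 : qhalf - qhalf^-1 != 0.
Proof.
apply: contraTneq isT => /eqP.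
rewrite subr_eq0 => /eqP /(congr1 (fun x => x * qhalf)).
rewrite mulVf ?qhalf_neq0 // -expr2 /qhalf -tofracXn -tofrac1.
move=> /eqP; rewrite tofrac_eq => /eqP /(congr1 (fun p : {poly int} => p`_0)).
by rewrite coefXn coef1.
Qed.

(* Stated over an abstract field because [field] unfolds the fraction field [Kq]
   and does not terminate there in practice. *)
Lemma qint_clear_denom (F : fieldType) (x w a : F) c m :
  x != 0 -> x - x^-1 != 0 -> a != 0 ->
  w * (x ^+ (c + c) - 1) * x ^+ m.+1
  = a * ((x ^+ 2 - 1) * x ^+ c *
         (w * ((x ^+ c - x ^- c) / (x - x^-1)) / a * x ^+ m)).
Proof.
move=> x0 xV0 a0; have xc0 : x ^+ c != 0 by rewrite expf_neq0.
have -> : x ^+ 2 - 1 = x * (x - x^-1) by field.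
have -> : x ^+ (c + c) - 1 = x ^+ c * (x ^+ c - x ^- c).
  by rewrite exprD; field.
rewrite exprS; set y := x - _ in xV0 *; set z := _ - _; field.
by rewrite a0.
Qed.

(* Clearing denominators leaves a polynomial with all coefficients divisible by
   [a] and lowest coefficient [- w]. *)
Lemma laurent_qint_dvd (w a : int) :
  a != 0 -> laurent par_q (w%:~R * qint a / a%:~R) -> (a %| w)%Z.
Proof.
(* [qint] is odd, so [qint a / a] does not change with the sign of [a]. *)
wlog [c ->] : a / exists c, a = Posz c.
  move=> IH; case: (intP a) => [|c|c] a0; first by [].
    by apply: IH a0; exists c.+1.
  rewrite qintN mulrNz invrN !(mulrN, mulNr) opprK dvdzE abszN.
  by apply: IH; first exists c.+1.
move=> a0 /laurent_par_q_clear [m [p Ep]].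
have c_gt0 : (0 < c)%N by rewrite lt0n.
have cF0 : (c%:Z)%:~R != 0 :> Kq.
  rewrite -(rmorph_int (@tofrac {poly int})) tofrac_eq0.
  by rewrite -(rmorph_int (@polyC int)) polyC_eq0 intz.
(* Both sides of [Ep] times [c * (X^2 - 1) * X^c]: the factor [X^2 - 1] cancels the denominator of
   [qint] up to a power of [X], and [X^c] clears the negative power in its numerator. *)
pose P : {poly int} := w%:~R * ('X^(c + c) - 1) * 'X^(m.+1).
pose Q : {poly int} := c%:Z%:~R * (('X^2 - 1) * 'X^c * p).
have EPQ : P = Q.
  apply/eqP; rewrite -tofrac_eq; apply/eqP.
  rewrite /P /Q !tofracM !tofracB !tofracXn !tofrac1 !rmorph_int -/qhalf -Ep.
  rewrite /qint -exprnN -exprnP.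
  exact: (qint_clear_denom _ _ _ qhalf_neq0 qhalf_sub_inv_neq0 cF0).
have coefM (u : int) (T : {poly int}) k : (u%:~R * T)`_k = u * T`_k.
  by rewrite -[u%:~R]/(intmul _ _) mulrzl coefMrz -mulrzl intz.
have coefP : P`_m.+1 = - w.
  rewrite /P -mulrA coefM coefMXn ltnn subnn coefB coefXn coef1.
  by rewrite eq_sym addn_eq0 -!leqn0 leqNgt c_gt0 /= sub0r mulrN1.
rewrite dvdzE -(abszN w) -dvdzE -coefP EPQ /Q coefM; exact: dvdz_mulr.
Qed.

Lemma column_ratio n (B L W : 'M[int]_n) :
  compatible_pair B L -> second_conditions B L W ->
  (forall i j, L i j != 0 -> (L i j %| W i j)%Z) ->
  forall j, exists r, forall i, W i j = r * L i j.
Proof.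
move=> [_ [d [d_gt0 _ BL]]] cond dvdLW.
have BLE k j : \sum_t B t k * L t j = if k == j then d 0 k else 0.
  have := congr1 (fun M : 'M_n => M k j) BL; rewrite !mxE => /esym.
  rewrite -mulrb => ->.
  by apply: eq_bigr => t _; rewrite mxE.
have BWE k j : k != j -> \sum_t B t k * W t j = 0.
  move=> kj; have [_ C3 C4] := cond _ _ kj.
  rewrite (bigID (fun t => L t j == 0)) /=.
  under eq_bigr => t _ do rewrite mulrC.
  rewrite C4 add0r.
  (* Without such a [v], every term left by (C4) has [B t k = 0]. *)
  have [/existsP[v /andP[Bv Lv]]|no_nbr] :=
    boolP [exists v, (B v k != 0) && (L v j != 0)]; last first.
    apply: big1 => t Lt; move: no_nbr => /existsPn/(_ t).
    by rewrite Lt andbT negbK => /eqP->; rewrite mul0r.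
  (* After multiplication by [L v j], (C3) trades [W t j * L v j] for [W v j * L t j], which leaves
     a multiple of an off-diagonal entry of [B^T *m L]. *)
  apply: (mulIf Lv); rewrite mul0r mulr_suml.
  transitivity (W v j * \sum_t B t k * L t j); last first.
    by rewrite BLE (negPf kj) mulr0.
  rewrite mulr_sumr [RHS](bigID (fun t => L t j == 0)) /=.
  rewrite [X in _ = X + _]big1 ?add0r; last first.
    by move=> t /eqP->; rewrite !mulr0.
  apply: eq_bigr => t _; have [->|Bt] := eqVneq (B t k) 0.
    by rewrite !mul0r mulr0.
  by rewrite -mulrA (C3 t v) ?mulf_neq0 //; ring.
move=> j; pose d' := \sum_t B t j * W t j.
have detB : \det B != 0.
  have : \det (B^T *m L) != 0.
    by rewrite BL det_diag; apply/prodf_neq0 => i _; rewrite gt_eqF.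
  by rewrite det_mulmx det_tr mulf_eq0 negb_or => /andP[].
(* The ratio of the columns is [d' / d 0 j], cross-multiplied to stay in the integers. *)
have ratio i : d 0 j * W i j = d' * L i j.
  pose v : 'cV[int]_n := \col_t (d 0 j * W t j - d' * L t j).
  have Bv : B^T *m v = 0.
    apply/colP => k; rewrite !mxE.
    transitivity (d 0 j * (\sum_t B t k * W t j)
                  - d' * (\sum_t B t k * L t j)).
      rewrite !mulr_sumr -sumrB; apply: eq_bigr => t _; rewrite !mxE; ring.
    rewrite BLE; have [->|kj] := eqVneq k j; first by rewrite -/d'; ring.
    by rewrite BWE // !mulr0 subr0.
  (* The adjugate replaces the inverse over the integers: it gives [\det B *: v = 0]. *)
  have := congr1 (mulmx (\adj B^T)) Bv.
  rewrite mulmxA mul_adj_mx mulmx0 mul_scalar_mx det_tr => /colP/(_ i).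
  rewrite !mxE => /eqP; rewrite mulf_eq0 (negPf detB) /= subr_eq0.
  by move/eqP.
(* A zero column [j] of [L] would make [d 0 j] vanish. One nonzero entry is enough to see that the
   ratio is an integer. *)
have [/existsP[i Li]|no_i] := boolP [exists i, L i j != 0]; last first.
  have := d_gt0 j; have := BLE j j; rewrite eqxx => <-.
  rewrite big1 ?ltxx // => t _; move: no_i => /existsPn/(_ t).
  by rewrite negbK => /eqP->; rewrite mulr0.
have /dvdzP[r Wr] := dvdLW _ _ Li.
have d'E : d' = d 0 j * r.
  by apply: (mulIf Li); rewrite -ratio Wr mulrA.
exists r => t; have dj : d 0 j != 0 by rewrite gt_eqF.
by apply: (mulfI dj); rewrite ratio d'E mulrA.
Qed.

Lemma block_proportional_of_column_ratio n (L W : 'M[int]_n) :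
  skew_symmetric L -> skew_symmetric W ->
  (forall j, exists r, forall i, W i j = r * L i j) ->
  block_proportional L W.
Proof.
move=> skL skW /fin_all_exists[r Wr].
have LN i j : L j i = - L i j.
  by have := congr1 (fun M : 'M_n => M i j) skL; rewrite !mxE.
have WN i j : W j i = - W i j.
  by have := congr1 (fun M : 'M_n => M i j) skW; rewrite !mxE.
have L0 i j : r i != r j -> L i j = 0.
  move=> rij; apply/eqP; have := WN j i.
  rewrite (Wr i j) (Wr j i) (LN i j) mulrN opprK => /eqP.
  by rewrite -subr_eq0 -mulrBl mulf_eq0 subr_eq0 eq_sym (negPf rij).
exists (preim_partition r [set: 'I_n]).
(* Any representative will do, as [r] is constant on blocks; the default 0 is never reached on a
   block, since it has an element. *)
exists (fun J : {set _} => if [pick j in J] is Some j then r j else 0).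
have partJ := preim_partitionP r [set: 'I_n].
have [/eqP covJ trivJ _] := and3P partJ.
have sameJ J i j : J \in preim_partition r [set: 'I_n] -> i \in J ->
    (j \in J) = (r i == r j).
  move=> JP iJ; rewrite -(def_pblock trivJ JP iJ).
  rewrite pblock_equivalence_partition ?inE //.
  by move=> x y z _ _ _; split=> // /eqP->.
split=> // [J1 J2 i j J1P J2P J12 iJ1 jJ2 | J i j JP iJ jJ].
  suff Lij : L i j = 0 by rewrite Wr Lij mulr0.
  apply: L0; rewrite -(sameJ J1) //.
  apply: contra J12 => jJ1.
  by rewrite -(def_pblock trivJ J1P jJ1) (def_pblock trivJ J2P jJ2).
case: pickP => [t tJ|/(_ i)]; last by rewrite iJ.
by rewrite Wr; congr (_ * _); apply/eqP; rewrite -(sameJ J).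
Qed.

Theorem corollary6p3 (n : nat) (Aq : quantum_cluster_algebra n)
  (Apq : second_quantization Aq) : trivial Apq.
Proof.
exists [::]; rewrite /mutated_seed /=.
have cmp := qca_compatible Aq; have [skL _] := cmp.
have cond := sq_compatible Apq [::].
have int_mx := sq_integral Apq [::].
move: cond int_mx; rewrite /mutated_seed /= sq_exch sq_form_q => cond int_mx.
apply: block_proportional_of_column_ratio => //; first exact: sq_form_p.
apply: column_ratio cmp cond _ => i j Lij.
by apply: laurent_qint_dvd => //; have := int_mx i j; rewrite mxE (negPf Lij).
Qed.
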